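(* Let $d\geq 3$ and $n\geq 2(d+1)$. Let $G\in\mathcal{G}_{n,d}$ and let $v$ be any vertex of $G$, and let $S={\rm N}_G[v]$ be the closed neighbourhood of $v$ in $G$. Then there is a sequence of $\Delta$-switches starting from $G$ which ends in a graph $G'\in\mathcal{G}_{n,d}$ in which $S$ is the vertex set of a connected component of $G'$ that is a complete graph (isomorphic to $K_{d+1}$).
   Context: All graphs are simple. $\mathcal{G}_{n,d}$ denotes the set of all $d$-regular graphs with vertex set $[n]$. ${\rm N}_G[v]={\rm N}_G(v)\cup\{v\}$ where ${\rm N}_G(v)$ is the set of neighbours of $v$. A $\Delta^+$-switch in a graph $G=(V,E)$: if $v,x,y,w,z$ are distinct vertices such that $yx, xv, vw, wz\in E$ and $xw, yz\notin E$, delete the edges $xy$, $wz$ and insert the edges $xw$, $yz$. A $\Delta^-$-switch is the reverse operation: if $v,x,y,w,z$ are distinct, $G$ contains the triangle on $v,x,w$ and the edge $yz$, and $xy, wz\notin E$, delete $xw$, $yz$ and insert $xy$, $wz$. A $\Delta$-switch is a $\Delta^+$-switch or a $\Delta^-$-switch. *)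

(* Defs.v *)
From HB Require Import structures.
From mathcomp Require Import all_boot.

Set Implicit Arguments.
Unset Strict Implicit.
Unset Printing Implicit Defensive.

(* A simple graph is given by its set of edges, which are unordered pairs of
   distinct vertices, so that equality of graphs is equality of edge sets. *)
Definition simple_edges (V : finType) (E : {set {set V}}) : bool :=
  [forall e in E, #|e| == 2].

Record sgraph (V : finType) : predArgType := SGraph {
  edges : {set {set V}};
  _ : simple_edges edges }.

HB.instance Definition _ (V : finType) := [isSub for @edges V].
HB.instance Definition _ (V : finType) := [Finite of sgraph V by <:].

Section Graphs.
Variable V : finType.
Implicit Types (G H : sgraph V) (v x y w z : V).

Definition adj G : rel V := fun x y => [set x; y] \in edges G.

Definition nbhd G v : {set V} := [set u | adj G v u].

Definition closed_nbhd G v : {set V} := v |: nbhd G v.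

Definition regular (d : nat) G : bool := [forall v, #|nbhd G v| == d].

Definition components G : {set {set V}} :=
  equivalence_partition (connect (adj G)) [set: V].

Definition complete_on G (S : {set V}) : bool :=
  [forall a in S, forall b in S, (a != b) ==> adj G a b].

Definition delta_plus_at G H v x y w z : bool :=
  [&& uniq [:: v; x; y; w; z],
      [&& adj G y x, adj G x v, adj G v w & adj G w z],
      ~~ adj G x w, ~~ adj G y z &
      edges H == (edges G :\: [set [set x; y]; [set w; z]])
                 :|: [set [set x; w]; [set y; z]]].

Definition delta_minus_at G H v x y w z : bool :=
  [&& uniq [:: v; x; y; w; z],
      [&& adj G v x, adj G x w, adj G v w & adj G y z],
      ~~ adj G x y, ~~ adj G w z &
      edges H == (edges G :\: [set [set x; w]; [set y; z]])
                 :|: [set [set x; y]; [set w; z]]].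

Definition delta_plus : rel (sgraph V) := fun G H =>
  [exists v, exists x, exists y, exists w, exists z,
     delta_plus_at G H v x y w z].

Definition delta_minus : rel (sgraph V) := fun G H =>
  [exists v, exists x, exists y, exists w, exists z,
     delta_minus_at G H v x y w z].

Definition delta_switch : rel (sgraph V) := fun G H =>
  delta_plus G H || delta_minus G H.

End Graphs.

Definition regular_graphs (n d : nat) : {set sgraph 'I_n} :=
  [set G | regular d G].

(* Main.v *)
(* Write N for the neighbourhood of v in G. Among the regular graphs reachable
   from G in which v still has neighbourhood N, take one with the most edges
   inside N; it suffices to show that N is then a clique.
   Suppose x, w in N are not adjacent, and let y, z be neighbours of x and w
   outside N[v]. The switch at v that gains xw must be blocked, so y = z or yz is
   an edge. As n >= 2(d+1) there is p outside N[v] and N[z], and counting the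
   neighbours of p, most of which turn out to lie in N[y], gives an edge pq with
   q outside N[v] and N[y]. The alternating hexagon replacing xy, wz, pq by xw,
   pz, yq would gain xw; if x has a neighbour u in N it decomposes into switches
   through xu, and when uq is already an edge, another decomposition or another
   hexagon works. Hence nonadjacent vertices of N are isolated
   in N, so N is independent; then any outer neighbour of w is adjacent or equal
   to all outer neighbours of every other vertex of N, which is too many when
   d >= 3. *)

Require Import Defs.
From mathcomp Require Import all_boot.

Set Implicit Arguments.
Unset Strict Implicit.
Unset Printing Implicit Defensive.

(** * Equality of unordered pairs, in a boolean form suited to rewriting *)

Definition same_pair (V : eqType) (x y a b : V) : bool :=
  (a == x) && (b == y) || (a == y) && (b == x).

Lemma eq_set2 (V : finType) (x y a b : V) :
  ([set a; b] == [set x; y]) = same_pair x y a b.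
Proof.
apply/eqP/idP; last first.
  by case/orP=> /andP[/eqP-> /eqP->] //; rewrite setUC.
move=> E.
have := set21 a b; have := set22 a b; have := set21 x y; have := set22 x y.
rewrite {1 2}E -{1 2}E !in_set2 /same_pair ![_ == a]eq_sym ![_ == b]eq_sym.
by do 4!case: eqP => //= ?; subst; rewrite ?eqxx.
Qed.

(** * Both kinds of switch as flips of an alternating 4-cycle *)

Section Flips.
Variable V : finType.
Implicit Types (G H : sgraph V) (a b c d x y w z : V).

Lemma adjC G x y : adj G x y = adj G y x.
Proof. by rewrite /adj setUC. Qed.

Lemma adjxx G x : adj G x x = false.
Proof.
rewrite /adj setUid; apply/negP=> xE; case: G xE => E /= /forall_inP sE.
by move/sE; rewrite cards1.
Qed.

Lemma adj_neq G x y : adj G x y -> x != y.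
Proof. by apply: contraTneq => ->; rewrite adjxx. Qed.

Lemma mem_nbhd G x y : (y \in nbhd G x) = adj G x y.
Proof. by rewrite inE. Qed.

Lemma mem_closed_nbhd G x y : (y \in closed_nbhd G x) = (y == x) || adj G x y.
Proof. by rewrite !inE. Qed.

Lemma closed_nbhdC G x y : (y \in closed_nbhd G x) = (x \in closed_nbhd G y).
Proof. by rewrite !mem_closed_nbhd eq_sym adjC. Qed.

Lemma card_closed_nbhd k G x : regular k G -> #|closed_nbhd G x| = k.+1.
Proof.
move=> /forallP/(_ x)/eqP regG.
by rewrite cardsU1 mem_nbhd adjxx regG add1n.
Qed.

Lemma card_exchange (A : {set V}) x y :
  x \in A -> y \notin A -> #|y |: A :\ x| = #|A|.
Proof.
by move=> xA yA; rewrite cardsU1 !inE negb_and yA orbT (cardsD1 x A) xA.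
Qed.

(** Replacing xy, wz by xw, yz, expressed on adjacency alone, so that chains of switches can be
    unfolded by rewriting. *)
Definition flipped G H x y w z :=
  forall a b, adj H a b =
    [|| same_pair x w a b, same_pair y z a b
      | [&& adj G a b, ~~ same_pair x y a b & ~~ same_pair w z a b]].

Lemma flipped_regular k G H x y w z :
    uniq [:: x; y; w; z] -> adj G x y -> adj G w z ->
    ~~ adj G x w -> ~~ adj G y z ->
  flipped G H x y w z -> regular k G -> regular k H.
Proof.
rewrite /= !inE !negb_or => /and4P[/and3P[xy xw xz] /andP[yw yz] wz _].
move=> Gxy Gwz Gxw Gyz adjH /forallP regG; apply/forallP=> a.
rewrite -(eqP (regG a)); apply/eqP.
have neqs := (negPf xy, negPf xw, negPf xz, negPf yw, negPf yz, negPf wz,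
  (eq_sym y x, eq_sym w x, eq_sym z x, eq_sym w y, eq_sym z y, eq_sym z w)).
(* Each of the four endpoints trades one neighbour t for one t'; all other vertices keep their
   neighbourhoods. *)
have exch s t t' : adj G s t -> ~~ adj G s t' ->
    (forall u, adj H s u = (u == t') || (u != t) && adj G s u) ->
  #|nbhd H s| = #|nbhd G s|.
  move=> Gst Gst' Hs; rewrite -(@card_exchange (nbhd G s) t t') ?mem_nbhd //.
  by apply: eq_card => u; rewrite !inE Hs.
have [-> {a}|ax] := eqVneq a x.
  apply: (exch x y w) => // u.
  by rewrite adjH /same_pair !(neqs, eqxx) /= ?(andbT, orbF) andbC.
have [-> {a ax}|ay] := eqVneq a y.
  apply: (exch y x z) => [||u] //; first by rewrite adjC.
  by rewrite adjH /same_pair !(neqs, eqxx) /= ?(andbT, orbF) andbC.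
have [-> {a ax ay}|aw] := eqVneq a w.
  apply: (exch w z x) => [||u] //; first by rewrite adjC.
  by rewrite adjH /same_pair !(neqs, eqxx) /= ?(andbT, orbF) andbC.
have [-> {a ax ay aw}|az] := eqVneq a z.
  apply: (exch z w y) => [||u]; [by rewrite adjC|by rewrite adjC|].
  by rewrite adjH /same_pair !(neqs, eqxx) /= ?(andbT, orbF) andbC.
apply: eq_card => b; rewrite !mem_nbhd adjH /same_pair.
by rewrite (negPf ax) (negPf ay) (negPf aw) (negPf az) /= andbT.
Qed.

(** The vertex c decides the kind of switch. If it is adjacent to x and w, it is the centre of a
    plus switch; if it is adjacent to x and y, then c, x, y form a triangle and the flip is a minus
    switch with y and w in exchanged roles. *)
Lemma flip k G c x y w z :
    uniq [:: c; x; y; w; z] -> adj G x y -> adj G w z ->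
    ~~ adj G x w -> ~~ adj G y z -> adj G c x -> adj G c w || adj G c y ->
    regular k G ->
  exists H, [/\ delta_switch G H, regular k H & flipped G H x y w z].
Proof.
move=> U Gxy Gwz Gxw Gyz Gcx Gc regG.
have U' : uniq [:: x; y; w; z] by case/andP: U.
pose E := (edges G :\: [set [set x; y]; [set w; z]])
  :|: [set [set x; w]; [set y; z]].
have sE : simple_edges E.
  move: U'; rewrite /= !inE !negb_or => /and4P[/and3P[_ xw _] /andP[_ yz] _ _].
  apply/forall_inP=> e; rewrite !inE.
  case/orP=> [/andP[_ eG]|/orP[]/eqP->]; last 2 first.
  - by rewrite cards2 xw.
  - by rewrite cards2 yz.
  by case: {+}G eG => ? /= /forall_inP; apply.
pose H := SGraph sE.
have fH : flipped G H x y w z.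
  move=> a b; rewrite {1}/adj /H /= !inE !eq_set2 -/(adj G a b) negb_or.
  by rewrite orbC -orbA [_ && adj G a b]andbC.
exists H; split=> //; last exact: flipped_regular fH regG.
apply/orP; case/orP: Gc => Gc; [left | right].
  apply/existsP; exists c; apply/existsP; exists x; apply/existsP; exists y.
  apply/existsP; exists w; apply/existsP; exists z.
  by rewrite /delta_plus_at U Gxw Gyz adjC Gxy adjC Gcx Gc Gwz /=.
apply/existsP; exists c; apply/existsP; exists x; apply/existsP; exists w.
apply/existsP; exists y; apply/existsP; exists z.
rewrite /delta_minus_at Gxw Gyz Gxy Gcx Gc Gwz /= eqxx !andbT.
move: U; rewrite /= !inE !negb_or (eq_sym w y).
by case/andP=> /and4P[-> -> -> ->] /and4P[/and3P[-> -> ->] /andP[-> ->] -> _].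
Qed.

End Flips.

(** * Blocked switches around a vertex whose neighbourhood has maximal edges *)

Lemma neqF (T : eqType) (a b : T) :
  a != b -> ((a == b) = false) * ((b == a) = false).
Proof. by rewrite [b == a]eq_sym => /negPf. Qed.

Section MaximalNeighbourhood.
Variables (V : finType) (G : sgraph V) (k : nat) (v : V).
Local Notation N := (nbhd G v).
Local Notation S := (closed_nbhd G v).
Implicit Types (H : sgraph V) (a b x y w z u p q : V).

Hypothesis regG : regular k G.
(** Maximality is by inclusion of the edges inside N; counting is left to the choice of the extremal
    graph. *)
Hypothesis maxG : forall H, connect (@delta_switch V) G H -> regular k H ->
  nbhd H v = N -> {in N &, forall a b, adj G a b -> adj H a b} ->
  {in N &, forall a b, adj H a b -> adj G a b}.

Lemma no_gain H x w :
    connect (@delta_switch V) G H -> regular k H ->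
    (forall b, adj H v b = adj G v b) ->
    {in N &, forall a b, adj G a b -> adj H a b} ->
    x \in N -> w \in N -> adj H x w -> adj G x w.
Proof.
move=> cH rH vH sH xN wN; apply: (maxG cH rH) => //.
by apply/setP=> b; rewrite !mem_nbhd.
Qed.

Lemma center_neq a : a \in N -> v != a.
Proof. by rewrite mem_nbhd => /adj_neq. Qed.

Lemma in_out_neq a t : a \in N -> t \notin S -> a != t.
Proof.
by move=> aN; apply: contraNneq => <-; rewrite mem_closed_nbhd -mem_nbhd aN orbT.
Qed.

Lemma center_out_neq t : t \notin S -> v != t.
Proof. by apply: contraNneq => <-; rewrite mem_closed_nbhd eqxx. Qed.

Lemma center_out_adj t : t \notin S -> adj G v t = false.
Proof. by rewrite mem_closed_nbhd => /norP[_ /negPf]. Qed.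

Lemma notin_closed_nbhd a b :
  a \notin closed_nbhd G b -> (a != b) * (adj G a b = false).
Proof. by rewrite mem_closed_nbhd adjC => /norP[-> /negPf]. Qed.

Lemma out_facts t : t \notin S ->
  (((v == t) = false) * ((t == v) = false)) * (adj G v t = false).
Proof.
by move=> tS; split; [apply/neqF/center_out_neq | apply: center_out_adj].
Qed.

Lemma in_facts a : a \in N ->
  (((v == a) = false) * ((a == v) = false)) * (adj G v a = true).
Proof.
by move=> aN; split; [apply/neqF/center_neq | rewrite -mem_nbhd].
Qed.

(** Otherwise the switch xy, wz -> xw, yz centred at v is legal. It changes no edge at v, and inside
    N its only effect is to gain xw, against maximality. *)
Lemma nonadjacent_stuck x w y z :
    x \in N -> w \in N -> x != w -> ~~ adj G x w ->
    y \notin S -> z \notin S -> adj G x y -> adj G w z ->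
  y \in closed_nbhd G z.
Proof.
move=> xN wN xw Gxw yS zS Gxy Gwz; apply: contraT => /notin_closed_nbhd[yz Gyz].
have io a t (aN : a \in N) (tS : t \notin S) := neqF (in_out_neq aN tS).
have F := (in_facts xN, in_facts wN, out_facts yS, out_facts zS, neqF xw,
  io _ _ xN yS, io _ _ xN zS, io _ _ wN yS, io _ _ wN zS, neqF yz).
have [H [sH rH fH]] : exists H, [/\ delta_switch G H, regular k H &
    flipped G H x y w z].
  by apply: (@flip _ k G v); rewrite /= ?inE ?F ?Gyz.
case/negP: Gxw; apply: (@no_gain H); rewrite ?connect1 //.
- by move=> b; rewrite fH /same_pair !F /= andbT.
- move=> a b aN bN Gab; rewrite fH /same_pair Gab.
  by rewrite !(io _ _ aN yS, io _ _ aN zS, io _ _ bN yS, io _ _ bN zS) !andbF ?orbT.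
by rewrite fH /same_pair !eqxx.
Qed.

(* The switches [xu, wz -> xw, uz], [xy, uq -> xu, yq]. *)
Lemma lateral_stuck x w u y z q :
    x \in N -> w \in N -> u \in N -> x != w -> ~~ adj G x w -> adj G u x ->
    y \notin S -> z \notin S -> q \notin S -> adj G x y -> adj G w z ->
    ~~ adj G u z -> adj G u q ->
  q \in closed_nbhd G y.
Proof.
move=> xN wN uN xw Gxw Gux yS zS qS Gxy Gwz Guz Guq.
apply: contraT => /notin_closed_nbhd[qy Gqy].
have ux := adj_neq Gux.
have uw : u != w by apply: contraNneq Gxw => <-; rewrite adjC.
have qz : q != z by apply: contraNneq Guz => <-.
have io a t (aN : a \in N) (tS : t \notin S) := neqF (in_out_neq aN tS).
have F := (in_facts xN, in_facts wN, in_facts uN,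
  out_facts yS, out_facts zS, out_facts qS, neqF xw, neqF ux, neqF uw,
  neqF qy, neqF qz,
  (io _ _ xN yS, io _ _ xN zS, io _ _ xN qS, io _ _ wN yS, io _ _ wN zS,
  io _ _ wN qS, io _ _ uN yS, io _ _ uN zS, io _ _ uN qS)).
have [H [sH rH fH]] : exists H, [/\ delta_switch G H, regular k H &
    flipped G H x u w z].
  by apply: (@flip _ k G v); rewrite /= ?inE ?F // adjC.
have [H2 [sH2 rH2 fH2]] : exists H2, [/\ delta_switch H H2, regular k H2 &
    flipped H H2 x y u q].
  by apply: (@flip _ k H v);
    rewrite ?fH /same_pair /= ?inE ?eqxx ?F ?Gxy ?Guq ?(adjC G y) ?Gqy ?andbF.
case/negP: Gxw; apply: (@no_gain H2) => //.
- exact: connect_trans (connect1 sH) (connect1 sH2).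
- by move=> b; rewrite fH2 fH /same_pair !F /= !andbT.
- move=> a b aN bN Gab; rewrite fH2 fH /same_pair Gab.
  rewrite !(io _ _ aN yS, io _ _ aN zS, io _ _ aN qS,
            io _ _ bN yS, io _ _ bN zS, io _ _ bN qS) !andbF /=.
  (* The only edge inside N that is lost on the way is xu, and the second switch restores it. *)
  by rewrite !andbT orbCA orbN orbT.
by rewrite fH2 fH /same_pair !eqxx !F.
Qed.

(* The switches [xu, pq -> xp, uq], [xp, wz -> xw, pz], [xy, uq -> xu, yq]. *)
Lemma hexagon_nonadjacent x w u y z p q :
    x \in N -> w \in N -> u \in N -> x != w -> ~~ adj G x w -> adj G u x ->
    y \notin S -> z \notin S -> p \notin S -> q \notin S ->
    adj G x y -> adj G w z -> adj G p q ->
    p \notin closed_nbhd G z -> q \notin closed_nbhd G y ->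
  adj G u q.
Proof.
move=> xN wN uN xw Gxw Gux yS zS pS qS Gxy Gwz Gpq pz' qy'; apply: contraT => Guq.
have [pz Gpz] := notin_closed_nbhd pz'; have [qy Gqy] := notin_closed_nbhd qy'.
(* With p as the outer neighbour of x, the basic switch would put p in N[z]. *)
have Gxp : adj G x p = false.
  by apply: contraNF pz' => Gxp; apply: (nonadjacent_stuck xN wN xw Gxw _ zS Gxp Gwz).
have ux := adj_neq Gux; have pq := adj_neq Gpq.
have uw : u != w by apply: contraNneq Gxw => <-; rewrite adjC.
have py : p != y by apply: contraFneq Gxp => ->.
have qz : q != z by apply: contraFneq Gpz => <-.
have io a t (aN : a \in N) (tS : t \notin S) := neqF (in_out_neq aN tS).
have F := (in_facts xN, in_facts wN, in_facts uN,
  out_facts yS, out_facts zS, out_facts pS, out_facts qS,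
  (neqF xw, neqF ux, neqF uw, neqF qy, neqF qz, neqF py, neqF pz, neqF pq),
  (io _ _ xN yS, io _ _ xN zS, io _ _ xN pS, io _ _ xN qS),
  (io _ _ wN yS, io _ _ wN zS, io _ _ wN pS, io _ _ wN qS),
  (io _ _ uN yS, io _ _ uN zS, io _ _ uN pS, io _ _ uN qS)).
have [H [sH rH fH]] : exists H, [/\ delta_switch G H, regular k H &
    flipped G H x u p q].
  by apply: (@flip _ k G v); rewrite /= ?inE ?F ?Gxp // adjC.
have [H2 [sH2 rH2 fH2]] : exists H2, [/\ delta_switch H H2, regular k H2 &
    flipped H H2 x p w z].
  by apply: (@flip _ k H v);
    rewrite ?fH /same_pair /= ?inE ?eqxx ?F ?Gwz ?Gpz ?(negPf Gxw) ?andbF.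
have [H3 [sH3 rH3 fH3]] : exists H3, [/\ delta_switch H2 H3, regular k H3 &
    flipped H2 H3 x y u q].
  by apply: (@flip _ k H2 v);
    rewrite ?fH2 ?fH /same_pair /= ?inE ?eqxx ?F ?Gxy ?(adjC G y) ?Gqy ?andbF.
case/negP: Gxw; apply: (@no_gain H3) => //.
- apply: connect_trans (connect1 sH) _.
  exact: connect_trans (connect1 sH2) (connect1 sH3).
- by move=> b; rewrite fH3 fH2 fH /same_pair !F /= !andbT.
- move=> a b aN bN Gab; rewrite fH3 fH2 fH /same_pair Gab.
  rewrite !(io _ _ aN yS, io _ _ aN zS, io _ _ aN pS, io _ _ aN qS,
            io _ _ bN yS, io _ _ bN zS, io _ _ bN pS, io _ _ bN qS) !andbF /=.
  by rewrite !andbT orbCA orbN orbT.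
by rewrite fH3 fH2 fH /same_pair !eqxx !F.
Qed.

(* The switches [xy, pq -> xp, yq], [xp, wz -> xw, pz]. *)
Lemma hexagon_triangle x w u y z p q :
    x \in N -> w \in N -> u \in N -> x != w -> ~~ adj G x w -> u != x ->
    y \notin S -> z \notin S -> p \notin S -> q \notin S ->
    adj G x y -> adj G w z -> adj G p q ->
    p \notin closed_nbhd G z -> q \notin closed_nbhd G y ->
  adj G u p -> ~~ adj G u q.
Proof.
move=> xN wN uN xw Gxw ux yS zS pS qS Gxy Gwz Gpq pz' qy' Gup.
apply/negP=> Guq.
have [pz Gpz] := notin_closed_nbhd pz'; have [qy Gqy] := notin_closed_nbhd qy'.
have Gxp : adj G x p = false.
  by apply: contraNF pz' => Gxp; apply: (nonadjacent_stuck xN wN xw Gxw _ zS Gxp Gwz).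
have pq := adj_neq Gpq.
have py : p != y by apply: contraFneq Gxp => ->.
have io a t (aN : a \in N) (tS : t \notin S) := neqF (in_out_neq aN tS).
have F := (in_facts xN, in_facts wN, in_facts uN,
  out_facts yS, out_facts zS, out_facts pS, out_facts qS,
  (neqF xw, neqF ux, neqF qy, neqF py, neqF pz, neqF pq),
  (io _ _ xN yS, io _ _ xN zS, io _ _ xN pS, io _ _ xN qS),
  (io _ _ wN yS, io _ _ wN zS, io _ _ wN pS, io _ _ wN qS),
  (io _ _ uN yS, io _ _ uN zS, io _ _ uN pS, io _ _ uN qS)).
(* This switch is centred at u instead of v: it is the minus switch on the triangle u, p, q. *)
have [H [sH rH fH]] : exists H, [/\ delta_switch G H, regular k H &
    flipped G H p q x y].
  by apply: (@flip _ k G u);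
    rewrite /= ?inE ?F ?Gqy ?Gup ?Guq ?orbT // adjC Gxp.
have [H2 [sH2 rH2 fH2]] : exists H2, [/\ delta_switch H H2, regular k H2 &
    flipped H H2 x p w z].
  by apply: (@flip _ k H v);
    rewrite ?fH /same_pair /= ?inE ?eqxx ?F ?Gwz ?Gpz ?(negPf Gxw) ?andbF.
case/negP: Gxw; apply: (@no_gain H2) => //.
- exact: connect_trans (connect1 sH) (connect1 sH2).
- by move=> b; rewrite fH2 fH /same_pair !F /= !andbT.
- move=> a b aN bN Gab; rewrite fH2 fH /same_pair Gab.
  rewrite !(io _ _ aN yS, io _ _ aN zS, io _ _ aN pS, io _ _ aN qS,
            io _ _ bN yS, io _ _ bN zS, io _ _ bN pS, io _ _ bN qS) !andbF /=.
  by rewrite orbT.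
by rewrite fH2 fH /same_pair !eqxx !F.
Qed.

(** * Counting outside N[v], and isolation of nonadjacent vertices *)

Lemma card_nbhd a : #|nbhd G a| = k.
Proof. by apply/eqP; move/forallP: regG. Qed.

(** Otherwise all k neighbours of x would be among the k - 1 vertices of S other than x and w. *)
Lemma outer_neighbour x w :
  x \in N -> w \in N -> x != w -> ~~ adj G x w -> exists2 y, y \notin S & adj G x y.
Proof.
move=> xN wN xw Gxw; apply/exists_inP; apply: contraT; rewrite negb_exists_in.
move=> /forall_inP noy.
have sub : nbhd G x \subset S :\ x :\ w.
  apply/subsetP=> t; rewrite mem_nbhd => Gxt; rewrite in_setD1 in_setD1.
  apply/and3P; split.
  - by apply: contraNneq Gxw => <-.
  - by rewrite eq_sym (adj_neq Gxt).
  by apply: contraLR Gxt => /noy.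
have xS : x \in S by rewrite mem_closed_nbhd -mem_nbhd xN orbT.
have wS : w \in S by rewrite mem_closed_nbhd -mem_nbhd wN orbT.
have := subset_leq_card sub; rewrite card_nbhd.
have := card_closed_nbhd v regG.
rewrite (cardsD1 x) xS (cardsD1 w) !in_setD1 eq_sym xw wS !add1n => -[<-].
by rewrite ltnn.
Qed.

(** At least k + 1 vertices lie outside S, but N[z] has at most k there, since it contains w. *)
Lemma outer_far w z :
    (k.+1).*2 <= #|V| -> w \in N -> adj G w z ->
  exists2 p, p \notin S & p \notin closed_nbhd G z.
Proof.
move=> leV wN Gwz; apply/exists_inP; apply: contraT; rewrite negb_exists_in.
move=> /forall_inP nop.
have wS : w \in S by rewrite mem_closed_nbhd -mem_nbhd wN orbT.
have wz : w \in closed_nbhd G z by rewrite mem_closed_nbhd (adjC G z) Gwz orbT.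
have sub : ~: S \subset closed_nbhd G z :\ w.
  apply/subsetP=> t; rewrite inE => tS; rewrite in_setD1.
  by rewrite (contraNneq _ tS) => [|->] //; move/nop: tS; rewrite negbK.
have := subset_leq_card sub.
have := card_closed_nbhd z regG; rewrite (cardsD1 w) wz add1n => -[->].
rewrite leqNgt -(ltn_add2l #|S|) cardsC (card_closed_nbhd v regG).
by rewrite addSn addnn (leq_trans _ leV) // doubleS.
Qed.

(** Without such a q, all neighbours of p except possibly w lie in N[y]. They avoid x and z, which
    are in N[y] but not adjacent to p, so only k - 1 places remain for them. *)
Lemma outer_edge x w y z p :
    x \in N -> w \in N -> x != w -> ~~ adj G x w ->
    y \notin S -> z \notin S -> p \notin S ->
    adj G x y -> adj G w z -> p \notin closed_nbhd G z ->
  exists q, [/\ q \notin S, adj G p q & q \notin closed_nbhd G y].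
Proof.
move=> xN wN xw Gxw yS zS pS Gxy Gwz pz'.
have [pz Gpz] := notin_closed_nbhd pz'.
have Gpx : adj G p x = false.
  rewrite adjC; apply: contraNF pz' => Gxp.
  exact: (nonadjacent_stuck xN wN xw Gxw pS zS Gxp Gwz).
have yz : z \in closed_nbhd G y.
  by rewrite closed_nbhdC; apply: (nonadjacent_stuck xN wN xw Gxw yS zS Gxy Gwz).
have yx : x \in closed_nbhd G y by rewrite mem_closed_nbhd (adjC G y) Gxy orbT.
(* If uw were not an edge, the basic switch would put p in N[z]. If uy were not, the lateral
   switches with x, y and w, z interchanged would do so. *)
have innbr u : u \in N -> adj G p u -> u != w -> u \in closed_nbhd G y.
  move=> uN Gpu uw; rewrite mem_closed_nbhd (adjC G y) orbC.
  have Gwu : adj G u w.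
    apply: contraNT pz' => Guw; apply: (nonadjacent_stuck uN wN uw Guw pS zS _ Gwz).
    by rewrite adjC.
  rewrite (_ : adj G u y) //; apply: contraNT pz' => Guy.
  by apply: (@lateral_stuck w x u z y p); rewrite // 1?eq_sym // adjC.
have [|noq] := boolP [exists q, [&& q \notin S, adj G p q & q \notin closed_nbhd G y]].
  by case/existsP=> q /and3P[]; exists q.
have sub q : adj G p q -> q != w -> q \in closed_nbhd G y.
  move=> Gpq qw; have [|qS] := boolP (q \in S).
    rewrite mem_closed_nbhd => /predU1P[qv|]; last first.
      by rewrite -mem_nbhd => qN; apply: innbr.
    by move: pS; rewrite mem_closed_nbhd -qv adjC Gpq orbT.
  apply: contraNT noq => qy; apply/existsP; exists q.
  by rewrite qS Gpq.
have xz := in_out_neq xN zS; have xp := in_out_neq xN pS.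
have cy := card_closed_nbhd y regG.
rewrite (cardsD1 x) yx (cardsD1 z) in_setD1 eq_sym xz yz !add1n in cy.
have {sub}sub q : adj G p q -> q != w -> q \in closed_nbhd G y :\ x :\ z.
  move=> Gpq qw; rewrite !in_setD1 sub // andbT.
  by apply/andP; split; apply: contraTneq Gpq => ->; rewrite ?Gpz ?Gpx.
(* The extra neighbour w is paid for by p itself, which then lies in N[y] and takes up one more
   place. *)
have [Gpw|Gpw] := boolP (adj G p w).
  have py : p \in closed_nbhd G y.
    rewrite closed_nbhdC; apply: (nonadjacent_stuck xN wN xw Gxw yS pS Gxy).
    by rewrite adjC.
  have {}sub : nbhd G p \subset w |: (closed_nbhd G y :\ x :\ z :\ p).
    apply/subsetP=> q; rewrite mem_nbhd => Gpq; rewrite in_setU1 in_setD1.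
    by have [//|qw] := eqVneq q w; rewrite sub // eq_sym (adj_neq Gpq).
  have := leq_trans (subset_leq_card sub) (leq_card_setU _ _).
  rewrite cards1 card_nbhd; move: cy.
  by rewrite (cardsD1 p) !in_setD1 pz eq_sym xp py !add1n => -[<-]; rewrite ltnn.
have {}sub : nbhd G p \subset closed_nbhd G y :\ x :\ z.
  apply/subsetP=> q; rewrite mem_nbhd => Gpq.
  by apply: sub => //; apply: contraNneq Gpw => <-.
by have := subset_leq_card sub; rewrite card_nbhd; case: cy => <-; rewrite ltnn.
Qed.

Lemma nonadjacent_isolated x w u :
    (k.+1).*2 <= #|V| ->
    x \in N -> w \in N -> u \in N -> x != w -> ~~ adj G x w -> ~~ adj G u x.
Proof.
move=> leV xN wN uN xw Gxw; apply/negP=> Gux.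
have wx : w != x by rewrite eq_sym.
have Gwx : ~~ adj G w x by rewrite adjC.
have ux := adj_neq Gux.
have uw : u != w by apply: contraNneq Gxw => <-; rewrite adjC.
have [y yS Gxy] := outer_neighbour xN wN xw Gxw.
have [z zS Gwz] := outer_neighbour wN xN wx Gwx.
have [p pS pz] := outer_far leV wN Gwz.
have [q [qS Gpq qy]] := outer_edge xN wN xw Gxw yS zS pS Gxy Gwz pz.
have Gqp : adj G q p by rewrite adjC.
have Guq : adj G u q.
  exact: (hexagon_nonadjacent xN wN uN xw Gxw Gux yS zS pS qS Gxy Gwz Gpq pz qy).
(* If uw is an edge, the mirrored hexagon, with x, y, p and w, z, q exchanged, makes up an edge;
   then u, p, q is a triangle. *)
have [Guw|Guw] := boolP (adj G u w).
  have Gup : adj G u p.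
    exact: (hexagon_nonadjacent wN xN uN wx Gwx Guw zS yS qS pS Gwz Gxy Gqp qy pz).
  have := hexagon_triangle xN wN uN xw Gxw ux yS zS pS qS Gxy Gwz Gpq pz qy Gup.
  by rewrite Guq.
have Guz : adj G u z.
  apply: contraNT qy => Guz.
  exact: (lateral_stuck xN wN uN xw Gxw Gux yS zS qS Gxy Gwz Guz Guq).
(* Now u takes the place of x, and x that of its neighbour in N. The vertex z serves as outer
   neighbour of both u and w, as the hexagon permits y = z. *)
have [q' [qS' Gpq' qz']] := outer_edge uN wN uw Guw zS zS pS Guz Gwz pz.
have Gxu : adj G x u by rewrite adjC.
have Gxq' : adj G x q'.
  exact: (hexagon_nonadjacent uN wN xN uw Guw Gxu zS zS pS qS' Guz Gwz Gpq' pz qz').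
case/negP: qz'; exact: (nonadjacent_stuck xN wN xw Gxw qS' zS Gxq' Gwz).
Qed.

(** * The case of an independent neighbourhood *)

Section Independent.
Hypothesis indN : {in N &, forall a b, ~~ adj G a b}.

Local Notation A x := (nbhd G x :\ v).

Lemma outer_notin x t : x \in N -> t \in A x -> t \notin S.
Proof.
move=> xN; rewrite in_setD1 mem_nbhd => /andP[tv Gxt].
rewrite mem_closed_nbhd (negPf tv) -mem_nbhd.
by apply: contraL Gxt => tN; apply: indN.
Qed.

Lemma card_outer x : x \in N -> #|A x|.+1 = k.
Proof.
by move=> xN; rewrite -(card_nbhd x) (cardsD1 v (nbhd G x)) mem_nbhd adjC -mem_nbhd xN.
Qed.

Lemma outer_subset x w z :
  x \in N -> w \in N -> x != w -> z \in A w -> A x \subset closed_nbhd G z.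
Proof.
move=> xN wN xw zA; apply/subsetP=> y yA.
apply: (nonadjacent_stuck xN wN xw (indN xN wN)).
- exact: outer_notin yA.
- exact: outer_notin zA.
- by move: yA; rewrite !inE => /andP[].
by move: zA; rewrite !inE => /andP[].
Qed.

(** For a common z, N[z] consists of x, w and [A x], since 2 + (k - 1) = k + 1. As [A u] also lies
    in N[z] and misses N, it equals [A x]; so z is adjacent to u, which is absent from that list. *)
Lemma outer_disjoint x w u z :
    x \in N -> w \in N -> u \in N -> x != w -> u != x -> u != w ->
  z \in A x -> z \notin A w.
Proof.
move=> xN wN uN xw ux uw zx; apply/negP=> zw.
have zS := outer_notin xN zx.
have out s t : t \in N -> s \in N -> t \notin A s.
  move=> tN sN; apply/negP=> /(outer_notin sN).
  by rewrite mem_closed_nbhd -mem_nbhd tN orbT.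
have nbr s : s \in N -> z \in A s -> s \in closed_nbhd G z.
  by move=> sN; rewrite !inE => /andP[_ Gsz]; rewrite (adjC G z) Gsz orbT.
have eqz : x |: (w |: A x) = closed_nbhd G z.
  apply/eqP; rewrite eqEcard !subUset !sub1set !nbr //.
  rewrite (outer_subset xN wN xw zw) /= (card_closed_nbhd z regG).
  by rewrite !cardsU1 in_setU1 !negb_or xw !out // -(card_outer xN).
have sub : A u \subset A x.
  apply/subsetP=> t tu; have tz := subsetP (outer_subset uN xN ux zx) _ tu.
  have tS := outer_notin uN tu.
  move: tz; rewrite -eqz !in_setU1.
  by case/or3P=> // /eqP tE; move: tS;
    rewrite mem_closed_nbhd -mem_nbhd tE ?xN ?wN orbT.
have eqA : A u = A x.
  by apply/eqP; rewrite eqEcard sub -ltnS !card_outer /=.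
have := nbr u uN; rewrite eqA zx -eqz => /(_ isT).
by rewrite !in_setU1 (negPf ux) (negPf uw) (negPf (out _ _ _ _)).
Qed.

(** For distinct x, w, u in N and z in [A w], the disjoint sets [A x] and [A u], of size k - 1 each,
    would both lie in N[z] without w and z, which has k - 1 elements. *)
Lemma nbhd_not_independent : k < 3.
Proof.
rewrite ltnNge; apply/negP=> k3.
have: 0 < #|N| by rewrite card_nbhd; case: (k) k3.
case/card_gt0P=> x xN; have cN := card_nbhd v.
rewrite (cardsD1 x) xN add1n in cN.
have: 0 < #|N :\ x| by move: k3; rewrite -cN; case: #|_|.
case/card_gt0P=> w; rewrite in_setD1 => /andP[wx wN].
rewrite (cardsD1 w) in_setD1 wx wN add1n in cN.
have: 0 < #|N :\ x :\ w| by move: k3; rewrite -cN; case: #|_|.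
case/card_gt0P=> u; rewrite !in_setD1 => /and3P[uw ux uN].
have [xw wu xu] : [/\ x != w, w != u & x != u] by rewrite ![_ == u]eq_sym eq_sym.
have: 0 < #|A w| by rewrite -ltnS card_outer // (leq_trans _ k3).
case/card_gt0P=> z zw.
have zx : z \notin A x by apply: (outer_disjoint wN xN uN).
have zu : z \notin A u by apply: (outer_disjoint wN uN xN).
have disj : [disjoint A x & A u].
  rewrite -setI_eq0; apply/eqP/setP=> t; rewrite in_setI in_set0.
  by apply/negP=> /andP[tx]; apply/negP; apply: (outer_disjoint xN uN wN).
have sub : A x :|: A u \subset closed_nbhd G z :\ w :\ z.
  apply/subsetP=> t tA; rewrite !in_setD1; apply/and3P; split.
  - by apply: contraTneq tA => ->; rewrite in_setU negb_or zx.
  - apply: contraTneq tA => ->; rewrite in_setU !in_setD1 !mem_nbhd.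
    by rewrite !(negPf (indN _ _)) // !andbF.
  case/setUP: tA.
    exact: (subsetP (outer_subset xN wN xw zw)).
  exact: (subsetP (outer_subset uN wN uw zw)).
have := subset_leq_card sub; rewrite cardsU disjoint_setI0 // cards0 subn0.
have := card_closed_nbhd z regG.
have Gzw : adj G z w by move: zw; rewrite in_setD1 mem_nbhd adjC => /andP[].
rewrite (cardsD1 w) (cardsD1 z) in_setD1 !mem_closed_nbhd Gzw eqxx orbT /=.
rewrite (adj_neq Gzw) !add1n => -[ck].
have -> : #|A x| = #|closed_nbhd G z :\ w :\ z|.
  by apply: succn_inj; rewrite card_outer.
rewrite -[X in _ <= X]addn0 leq_add2l leqn0 => /eqP Au0.
by move: k3; rewrite -(card_outer uN) Au0.
Qed.

End Independent.

(** A nonadjacent pair x, w isolates x in N. Every other vertex of N is then nonadjacent to x, hence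
    isolated too, and N is independent. *)
Lemma nbhd_complete :
  2 < k -> (k.+1).*2 <= #|V| -> {in N &, forall a b, a != b -> adj G a b}.
Proof.
move=> k3 leV x w xN wN xw; apply: contraT => Gxw.
suff /nbhd_not_independent: {in N &, forall a b, ~~ adj G a b}.
  by rewrite ltnNge k3.
have nx u : u \in N -> ~~ adj G u x.
  by move=> uN; apply: (nonadjacent_isolated leV xN wN uN xw Gxw).
move=> a b aN bN; have [->|ax] := eqVneq a x; first by rewrite adjC nx.
by rewrite adjC; apply: (nonadjacent_isolated leV aN xN bN ax (nx _ aN)).
Qed.

End MaximalNeighbourhood.

(** * The extremal graph and its complete component *)

Section CompleteNeighbourhood.
Variables (V : finType) (k : nat).
Implicit Types (G H : sgraph V) (v : V).

Lemma reach_complete_nbhd G v :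
    2 < k -> (k.+1).*2 <= #|V| -> regular k G ->
  exists H, [/\ connect (@delta_switch V) G H, regular k H,
    nbhd H v = nbhd G v & complete_on H (closed_nbhd H v)].
Proof.
move=> k3 leV regG.
pose P H := [&& connect (@delta_switch V) G H, regular k H & nbhd H v == nbhd G v].
(* Ordered pairs count each edge inside N twice, which leaves the maximum at the same graphs. *)
pose E H := [set e : V * V | [&& e.1 \in nbhd G v, e.2 \in nbhd G v & adj H e.1 e.2]].
have PG : P G by rewrite /P connect0 regG eqxx.
case: (arg_maxnP (fun H => #|E H|) PG) => H /and3P[cH rH /eqP vH] maxH.
exists H; split=> //.
(* Maximality by count gives maximality by inclusion: [E H] is contained in [E K] and is at least as
   large. *)
have maxH' K : connect (@delta_switch V) H K -> regular k K ->
  nbhd K v = nbhd H v -> {in nbhd H v &, forall a b, adj H a b -> adj K a b} ->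
  {in nbhd H v &, forall a b, adj K a b -> adj H a b}.
  move=> cK rK vK sHK a b aN bN Kab.
  have PK : P K by rewrite /P (connect_trans cH cK) rK vK vH eqxx.
  have sub : E H \subset E K.
    apply/subsetP=> -[s t]; rewrite !inE -!mem_nbhd -vH /= => /and3P[sN tN st].
    rewrite sN tN /=; move: st; rewrite !mem_nbhd; exact: sHK.
  have /eqP eqE : E H == E K by rewrite eqEcard sub; exact: maxH.
  have: (a, b) \in E H by rewrite eqE inE /= -vH aN bN.
  by rewrite inE => /and3P[].
have cplN := nbhd_complete rH maxH' k3 leV.
apply/forall_inP=> a; rewrite mem_closed_nbhd => aS.
apply/forall_inP=> b; rewrite mem_closed_nbhd => bS; apply/implyP=> ab.
case/predU1P: aS => [eav|va]; case/predU1P: bS => [ebv|vb].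
- by rewrite eav ebv eqxx in ab.
- by rewrite eav.
- by rewrite ebv adjC.
by apply: cplN; rewrite ?mem_nbhd.
Qed.

(** For each a in the clique N[v], N[v] is contained in N[a]; both have k + 1 elements, so they
    coincide and no edge leaves N[v]. *)
Lemma complete_component H v :
  regular k H -> complete_on H (closed_nbhd H v) -> closed_nbhd H v \in components H.
Proof.
move=> rH /forall_inP cpl.
have vS : v \in closed_nbhd H v by rewrite mem_closed_nbhd eqxx.
have closedS a b : a \in closed_nbhd H v -> adj H a b -> b \in closed_nbhd H v.
  move=> aS Hab.
  have sub : closed_nbhd H v \subset closed_nbhd H a.
    apply/subsetP=> c cS; rewrite mem_closed_nbhd.
    have [//|ca] := eqVneq c a.
    by move/forall_inP/(_ c cS)/implyP: (cpl a aS); apply; rewrite eq_sym.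
  have /eqP -> : closed_nbhd H v == closed_nbhd H a.
    by rewrite eqEcard sub !(card_closed_nbhd _ rH) /=.
  by rewrite mem_closed_nbhd Hab orbT.
apply/imsetP; exists v; rewrite ?inE //; apply/setP=> b; rewrite inE in_setT /=.
apply/idP/idP=> [|/connectP[p]].
  rewrite mem_closed_nbhd => /predU1P[->|]; first exact: connect0.
  exact: connect1.
suff pathS c : c \in closed_nbhd H v -> path (adj H) c p ->
    last c p \in closed_nbhd H v.
  by move=> pth ->; exact: pathS vS pth.
elim: p c => //= a p IHp c cS /andP[Hca].
exact: IHp (closedS c a cS Hca).
Qed.

End CompleteNeighbourhood.

Theorem theorem3p1 (n d : nat) (hd : 3 <= d) (hn : 2 * (d + 1) <= n)
    (G : sgraph 'I_n) (hG : G \in regular_graphs n d) (v : 'I_n) :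
  exists s : seq (sgraph 'I_n),
    path (@delta_switch 'I_n) G s /\
    (let G' := last G s in
     let S := closed_nbhd G v in
     [/\ G' \in regular_graphs n d,
         S \in components G',
         complete_on G' S
       & #|S| = d + 1]).
Proof.
have regG : regular d G by rewrite inE in hG.
have leV : (d.+1).*2 <= #|'I_n| by rewrite card_ord -mul2n -(addn1 d).
have [H [cH rH vH cplH]] := reach_complete_nbhd v hd leV regG.
have eqS : closed_nbhd H v = closed_nbhd G v by rewrite /closed_nbhd vH.
case/connectP: cH => s pth lastH; exists s; split=> //=.
rewrite -lastH -eqS; split=> //; first by rewrite inE.
  exact: complete_component rH cplH.
by rewrite (card_closed_nbhd v rH) addn1.
Qed.
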